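(* $\ell_\infty$ is $(\ell_\infty\setminus c_0)$-embeddable. As a consequence, every $\ell_\infty$-embeddable algebra and every $\ell_\infty$-embeddable Banach space is $(\ell_\infty\setminus c_0)$-embeddable. In particular, every subalgebra and every closed subspace of $\ell_\infty$ is $(\ell_\infty\setminus c_0)$-embeddable.
   Context: All algebras are associative and complex; $\ell_\infty$ is the $C^*$-algebra of bounded complex sequences and $c_0$ its ideal of null sequences. Let $B$ be a $C^*$-algebra. A $B$-embedding of $A$ is an injective linear map $\phi\colon A\to B$ preserving the structure of $A$: isometric if $A$ is a Banach space; an algebra homomorphism if $A$ is an algebra; isometric and an algebra homomorphism if $A$ is a Banach algebra; a $^*$-homomorphism if $A$ is a $C^*$-algebra (in particular, for $A=\ell_\infty$). $A$ is $B$-embeddable if a $B$-embedding of $A$ exists. For $Y\subset B$, $A$ is $(B\setminus Y)$-embeddable if there is a $B$-embedding $\phi$ of $A$ with $\phi(A)\cap Y=\{0\}$. *)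

(* Defs.v *)
From HB Require Import structures.
From mathcomp Require Import all_boot all_order all_algebra.
From mathcomp Require Import all_classical all_reals all_analysis.
From mathcomp Require Import complex.
Set Implicit Arguments.
Unset Strict Implicit.
Unset Printing Implicit Defensive.
Import Order.TTheory GRing.Theory Num.Theory.
Import numFieldNormedType.Exports.
Local Open Scope classical_set_scope.
Local Open Scope ring_scope.
Local Open Scope complex_scope.

(* The complex numbers are R[i] for R : realType, seen as a Banach space over
   themselves. Norms on complex vector spaces take values in R[i]. *)
HB.instance Definition _ (R : realType) := NormedModule.copy R[i] R[i]^o.

Section complex_complete.
Variable R : realType.

Lemma normc_leD (z : R[i]) : `|z| <= `|complex.Re z|%:C + `|complex.Im z|%:C.
Proof.
case: z => a b /=; rewrite normc_def /= -rmorphD lecR.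
rewrite -(ger0_norm (addr_ge0 (normr_ge0 a) (normr_ge0 b))) -sqrtr_sqr.
apply: ler_wsqrtr; rewrite sqrrD !real_normK ?num_real// -addrA.
by rewrite lerD2l addrC lerDl mulrn_wge0 ?mulr_ge0.
Qed.

Lemma normc_ge_Im (z : R[i]) : `|complex.Im z|%:C <= `|z|.
Proof.
case: z => a b /=; rewrite normc_def /= lecR -sqrtr_sqr.
by apply: ler_wsqrtr; rewrite lerDr sqr_ge0.
Qed.

Lemma complex_complete (F : set_system R[i]) :
  ProperFilter F -> cauchy F -> cvg F.
Proof.
move=> FF /cauchy_ballP Fc.
have key (p : R[i] -> R) : (forall z w, p (z - w) = p z - p w) ->
    (forall z : R[i], `|p z|%:C <= `|z|) -> cvg (p @ F).
  move=> pB ple; apply/cauchy_cvgP/cauchy_ballP => e e0.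
  have eC0 : 0 < e%:C by rewrite ltcR.
  have [[A B] /= [FA FB] AB] := Fc _ eC0.
  exists (p @` A, p @` B) => /=.
    by split; [apply: filterS FA|apply: filterS FB] => z Az; exists z.
  move=> [_ _] /= [[x Ax <-] [y By <-]].
  have := AB (x, y) (conj Ax By); rewrite -!ball_normE /= => xye.
  rewrite -pB -ltcR; exact: le_lt_trans (ple _) xye.
have cRe : cvg (@complex.Re R @ F).
  by apply: key (@normc_ge_Re R) => -[? ?] [? ?].
have cIm : cvg (@complex.Im R @ F).
  by apply: key normc_ge_Im => -[? ?] [? ?].
apply/cvg_ex; exists (lim (@complex.Re R @ F) +i* lim (@complex.Im R @ F)).
apply/cvgrPdist_lt => e e0.
have [r r0 er] : exists2 r : R, 0 < r & e = r%:C.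
  case: e e0 => r i; rewrite ltcE /= => /andP[/eqP -> r0].
  by exists r.
have r20 : 0 < r / 2 by rewrite divr_gt0.
have nRe : \forall z \near F, `|lim (@complex.Re R @ F) - complex.Re z| < r / 2.
  by apply: (@cvgr_dist_lt _ _ _ _ _ (@complex.Re R) _ cRe).
have nIm : \forall z \near F, `|lim (@complex.Im R @ F) - complex.Im z| < r / 2.
  by apply: (@cvgr_dist_lt _ _ _ _ _ (@complex.Im R) _ cIm).
apply: filterS2 nRe nIm => -[a b] /= ha hb.
apply: le_lt_trans (normc_leD _) _; rewrite er -rmorphD ltcR /=.
by rewrite [r]splitr ltrD.
Qed.

End complex_complete.

HB.instance Definition _ (R : realType) :=
  Uniform_isComplete.Build R[i] (@complex_complete R).

(* The algebras of MathComp are unital; here neither a unit nor commutativity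
   is required. *)
HB.mixin Record Lmodule_isAssocAlgebra (K : pzRingType) A of GRing.Lmodule K A := {
  amul : A -> A -> A;
  amulA : associative amul;
  amulDl : left_distributive amul +%R;
  amulDr : right_distributive amul +%R;
  amulZl : forall (k : K) (x y : A), amul (k *: x) y = k *: amul x y;
  amulZr : forall (k : K) (x y : A), amul x (k *: y) = k *: amul x y
}.

#[short(type="assocAlgType")]
HB.structure Definition AssocAlgebra (K : pzRingType) :=
  {A of GRing.Lmodule K A & Lmodule_isAssocAlgebra K A}.

HB.mixin Record isCstarAlgebra (K : numClosedFieldType) A
    of CompleteNormedModule K A & AssocAlgebra K A := {
  star : A -> A;
  starK : involutive star;
  starD : {morph star : x y / x + y};
  starZ : forall (k : K) (x : A), star (k *: x) = Num.conj k *: star x;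
  starM : forall x y : A, star (amul x y) = amul (star y) (star x);
  norm_amul_le : forall x y : A, `|amul x y| <= `|x| * `|y|;
  norm_star_amul : forall x : A, `|amul (star x) x| = `|x| ^+ 2
}.

#[short(type="cstarAlgType")]
HB.structure Definition CstarAlgebra (K : numClosedFieldType) :=
  {A of CompleteNormedModule K A & AssocAlgebra K A & isCstarAlgebra K A}.

(* The structure of A that an embedding preserves is that of an algebra, of a
   Banach space or of a C*-algebra; hence one notion for each. *)
Section embeddings.
Variables (K : numClosedFieldType) (B : cstarAlgType K).

Definition algebra_embedding (A : assocAlgType K) (phi : {linear A -> B}) :=
  injective phi /\ {morph phi : x y / amul x y >-> amul x y}.

Definition banach_embedding (A : completeNormedModType K)
    (phi : {linear A -> B}) :=
  injective phi /\ forall x, `|phi x| = `|x|.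

Definition cstar_embedding (A : cstarAlgType K) (phi : {linear A -> B}) :=
  [/\ injective phi, {morph phi : x y / amul x y >-> amul x y}
    & {morph phi : x / star x >-> star x}].

Definition algebra_embeddable (A : assocAlgType K) :=
  exists phi : {linear A -> B}, algebra_embedding phi.

Definition banach_embeddable (A : completeNormedModType K) :=
  exists phi : {linear A -> B}, banach_embedding phi.

Definition algebra_embeddable_off (Y : set B) (A : assocAlgType K) :=
  exists2 phi : {linear A -> B},
    algebra_embedding phi & range phi `&` Y = [set 0].

Definition banach_embeddable_off (Y : set B) (A : completeNormedModType K) :=
  exists2 phi : {linear A -> B},
    banach_embedding phi & range phi `&` Y = [set 0].

Definition cstar_embeddable_off (Y : set B) (A : cstarAlgType K) :=
  exists2 phi : {linear A -> B},
    cstar_embedding phi & range phi `&` Y = [set 0].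

End embeddings.

HB.mixin Record isAmulClosed (K : pzRingType) (A : assocAlgType K)
    (S : {pred A}) := {
  rpred_amul : {in S &, forall x y, amul x y \in S}
}.

#[short(type="subalgebra")]
HB.structure Definition Subalgebra (K : pzRingType) (A : assocAlgType K) :=
  {S of GRing.SubmodClosed K S & isAmulClosed K A S}.

HB.mixin Record isTopClosed (K : numDomainType) (V : normedModType K)
    (S : {pred V}) := {
  pred_closed : closed [set x | x \in S]
}.

#[short(type="closedSubspace")]
HB.structure Definition ClosedSubspace (K : numDomainType)
    (V : normedModType K) :=
  {S of GRing.SubmodClosed K S & isTopClosed K V S}.

Section subalgebra_type.
Variables (K : pzRingType) (A : assocAlgType K) (S : subalgebra A).

Definition subalgebra_type : Type := {x | x \in (S : {pred A})}.

HB.instance Definition _ := [isSub for @sval A (fun x => x \in (S : {pred A}))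
  : subalgebra_type -> A].
HB.instance Definition _ := [Choice of subalgebra_type by <:].
HB.instance Definition _ := [SubChoice_isSubLmodule of subalgebra_type by <:].

Let mul (x y : subalgebra_type) : subalgebra_type :=
  Sub (amul (val x) (val y)) (rpred_amul _ _ (valP x) (valP y)).

Let mulA : associative mul.
Proof. by move=> x y z; apply: val_inj; rewrite /= amulA. Qed.

Let mulDl : left_distributive mul +%R.
Proof. by move=> x y z; apply: val_inj; rewrite /= amulDl. Qed.

Let mulDr : right_distributive mul +%R.
Proof. by move=> x y z; apply: val_inj; rewrite /= amulDr. Qed.

Let mulZl k x y : mul (k *: x) y = k *: mul x y.
Proof. by apply: val_inj; rewrite /= amulZl. Qed.

Let mulZr k x y : mul x (k *: y) = k *: mul x y.
Proof. by apply: val_inj; rewrite /= amulZr. Qed.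

HB.instance Definition _ := Lmodule_isAssocAlgebra.Build K subalgebra_type
  mulA mulDl mulDr mulZl mulZr.

End subalgebra_type.

Section closed_subspace_type.
Variables (K : numFieldType) (V : completeNormedModType K).
Variable S : closedSubspace V.

Definition subspace_type : Type := {x | x \in (S : {pred V})}.

HB.instance Definition _ := [isSub for @sval V (fun x => x \in (S : {pred V}))
  : subspace_type -> V].
HB.instance Definition _ := [Choice of subspace_type by <:].
HB.instance Definition _ := [SubChoice_isSubLmodule of subspace_type by <:].

Let norm (x : subspace_type) : K := `|val x|.

Let norm_leD x y : norm (x + y) <= norm x + norm y.
Proof. exact: ler_normD. Qed.

Let normZ (k : K) x : norm (k *: x) = `|k| * norm x.
Proof. exact: normrZ. Qed.

Let norm_eq0 x : norm x = 0 -> x = 0.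
Proof. by move=> /normr0_eq0 x0; apply: val_inj. Qed.

HB.instance Definition _ := Lmodule_isNormed.Build K subspace_type
  norm_leD normZ norm_eq0.

Lemma subspace_complete (F : set_system subspace_type) :
  ProperFilter F -> cauchy F -> cvg F.
Proof.
move=> FF /cauchy_ballP Fc.
have cF : cvg ((val : subspace_type -> V) @ F).
  apply/cauchy_cvgP/cauchy_ballP => e e0.
  have [[A B] /= [FA FB] AB] := Fc _ e0.
  exists ((val : _ -> V) @` A, (val : _ -> V) @` B) => /=.
    by split; [apply: filterS FA|apply: filterS FB] => z Az; exists z.
  move=> [_ _] /= [[x Ax <-] [y By <-]].
  by have := AB (x, y) (conj Ax By); rewrite -!ball_normE.
have lS : lim ((val : subspace_type -> V) @ F) \in (S : {pred V}).
  apply: (closed_cvg (fun x : V => x \in (S : {pred V})) pred_closed _ _ cF).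
  by apply: filterE => x; exact: (valP x).
apply/cvg_ex; exists (exist (fun x => x \in (S : {pred V})) _ lS : subspace_type); apply/cvgrPdist_lt => e e0.
exact: (@cvgr_dist_lt _ _ _ _ _ _ _ cF).
Qed.

HB.instance Definition _ := Uniform_isComplete.Build subspace_type
  subspace_complete.

End closed_subspace_type.

Section linf.
Variable R : realType.
Local Notation C := R[i].

Definition bounded_seq : {pred nat -> C} := fun x => `[< bounded_fun x >].

Lemma bounded_seqP (x : nat -> C) :
  reflect (exists M : R, forall n, `|x n| <= M%:C) (x \in bounded_seq).
Proof.
apply: (iffP (@asboolP (bounded_fun x))) => [/ex_bound|[M Mx]].
  case=> [|M Mx]; first exact: (@globally_properfilter _ _ 0%N).
  have {}Mx n : `|x n| <= M by exact: Mx.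
  exists (complex.Re M) => n; rewrite RRe_real//.
  exact: ger0_real (le_trans (normr_ge0 _) (Mx 0%N)).
apply/ex_bound; first exact: (@globally_properfilter _ _ 0%N).
by exists M%:C => n _; exact: Mx.
Qed.

Lemma bounded_seq_submod : submod_closed bounded_seq.
Proof.
split; first by apply/bounded_seqP; exists 0 => n; rewrite normr0.
move=> k x y /bounded_seqP[M Mx] /bounded_seqP[N Ny].
have [r kr] : exists r : R, `|k| = r%:C.
  by exists (complex.Re `|k|); rewrite RRe_real ?normr_real.
apply/bounded_seqP; exists (r * M + N) => n.
have -> : (r * M + N)%:C = `|k| * M%:C + N%:C by rewrite kr rmorphD rmorphM.
apply: le_trans (ler_normD _ _) _; rewrite normrM lerD//.
by rewrite ler_wpM2l.
Qed.

HB.instance Definition _ := GRing.isSubmodClosed.Build C (nat -> C) bounded_seq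
  bounded_seq_submod.

Definition linf : Type := {x | x \in bounded_seq}.

Definition Linf (x : nat -> C) (xb : x \in bounded_seq) : linf :=
  exist (fun x => x \in bounded_seq) x xb.

HB.instance Definition _ := [isSub for @sval (nat -> C)
  (fun x => x \in bounded_seq) : linf -> (nat -> C)].
HB.instance Definition _ := [Choice of linf by <:].
HB.instance Definition _ := [SubChoice_isSubLmodule of linf by <:].

Definition linf_norm (x : linf) : C :=
  (sup (range (fun n => complex.Re `|val x n|)))%:C.

Lemma linf_norm_le (x : linf) (M : C) :
  linf_norm x <= M <-> forall n, `|val x n| <= M.
Proof.
have Re_le (z : C) (r : R) : (complex.Re `|z| <= r) = (`|z| <= r%:C).
  by rewrite -[in RHS](RRe_real (normr_real z)) lecR.
have [N Nx] := bounded_seqP _ (valP x).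
have hs : has_sup (range (fun n => complex.Re `|val x n|)).
  split; first by exists (complex.Re `|val x 0|), 0.
  by exists N => _ [n _ <-]; rewrite Re_le.
have ub n : `|val x n| <= linf_norm x.
  by rewrite -Re_le; apply: (sup_upper_bound hs); exists n.
split=> [xM n|xM]; first exact: le_trans (ub n) xM.
have MR : M \is Num.real by exact: ger0_real (le_trans (normr_ge0 _) (xM 0)).
rewrite -(RRe_real MR) lecR; apply: ge_sup; first by case: hs.
by move=> _ [n _ <-]; rewrite Re_le RRe_real.
Qed.

Lemma linf_norm_ub (x : linf) n : `|val x n| <= linf_norm x.
Proof. by move: n; apply/linf_norm_le. Qed.

Let norm_leD x y : linf_norm (x + y) <= linf_norm x + linf_norm y.
Proof.
apply/linf_norm_le => n; apply: le_trans (ler_normD _ _) _.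
by rewrite lerD ?linf_norm_ub.
Qed.

Let norm_leZ (k : C) x : linf_norm (k *: x) <= `|k| * linf_norm x.
Proof.
by apply/linf_norm_le => n; rewrite [val _ _]/(k * _) normrM ler_wpM2l ?linf_norm_ub.
Qed.

Let normZ (k : C) x : linf_norm (k *: x) = `|k| * linf_norm x.
Proof.
apply/eqP; rewrite eq_le norm_leZ /=.
have [->|k0] := eqVneq k 0.
  by rewrite normr0 mul0r (le_trans (normr_ge0 _) (linf_norm_ub _ 0)).
rewrite mulrC -ler_pdivlMr ?normr_gt0// mulrC -normfV.
by have := norm_leZ k^-1 (k *: x); rewrite scalerA mulVf// scale1r.
Qed.

Let norm_eq0 x : linf_norm x = 0 -> x = 0.
Proof.
move=> x0; apply: val_inj; apply/funext => n; apply/eqP.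
by rewrite -normr_le0 -x0 linf_norm_ub.
Qed.

HB.instance Definition _ := Lmodule_isNormed.Build C linf
  norm_leD normZ norm_eq0.

Lemma linf_complete (F : set_system linf) : ProperFilter F -> cauchy F -> cvg F.
Proof.
move=> FF /cauchy_ballP Fc.
have c n : cvg ((fun x : linf => val x n) @ F).
  apply/cauchy_cvgP/cauchy_ballP => e e0.
  have [[A B] /= [FA FB] AB] := Fc _ e0.
  exists ((fun x : linf => val x n) @` A, (fun x : linf => val x n) @` B) => /=.
    by split; [apply: filterS FA|apply: filterS FB] => z Az; exists z.
  move=> [_ _] /= [[x Ax <-] [y By <-]].
  have := AB (x, y) (conj Ax By); rewrite -!ball_normE /=.
  by apply: le_lt_trans; exact: (linf_norm_ub (x - y)).
pose l n : C := lim ((fun x : linf => val x n) @ F).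
have lc e : 0 < e ->
    \forall x \near F, forall n, `|l n - val x n| <= e.
  move=> e0; have e20 : 0 < e / 2 by rewrite divr_gt0.
  have [[A B] /= [FA FB] AB] := Fc _ e20.
  apply: filterS FB => y By n.
  have nl := @cvgr_dist_lt _ _ _ _ _ _ _ (c n) _ e20.
  have [x [Ax lx]] := filter_ex (filterI FA (nl _)).
  rewrite (splitr e).
  apply: le_trans (ler_distD (val x n) _ _) _; apply/lerD; first exact: ltW.
  have := AB (x, y) (conj Ax By); rewrite -!ball_normE /= => /ltW.
  by apply: le_trans; exact: (linf_norm_ub (x - y)).
have lb : l \in bounded_seq.
  have [x lx] := filter_ex (lc 1 ltr01).
  have [M Mx] := bounded_seqP _ (valP x).
  apply/bounded_seqP; exists (1 + M) => n.
  rewrite -[l n](subrK (val x n)) rmorphD; apply: le_trans (ler_normD _ _) _.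
  by rewrite lerD// ?lx.
apply/cvg_ex; exists (Linf lb); apply/cvgrPdist_le => e e0.
apply: filterS (lc _ e0) => x lx.
by apply/linf_norm_le => n; exact: lx.
Qed.

HB.instance Definition _ := Uniform_isComplete.Build linf linf_complete.

Let mul_bounded (x y : linf) : (fun n => val x n * val y n) \in bounded_seq.
Proof.
have [M Mx] := bounded_seqP _ (valP x); have [N Ny] := bounded_seqP _ (valP y).
by apply/bounded_seqP; exists (M * N) => n; rewrite normrM rmorphM ler_pM.
Qed.

Definition linf_mul (x y : linf) : linf := Linf (mul_bounded x y).

Let star_bounded (x : linf) : (fun n => Num.conj (val x n)) \in bounded_seq.
Proof.
have [M Mx] := bounded_seqP _ (valP x).
by apply/bounded_seqP; exists M => n; rewrite norm_conjC.
Qed.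

Definition linf_star (x : linf) : linf := Linf (star_bounded x).

Let mulA : associative linf_mul.
Proof. by move=> x y z; apply/val_inj/funext => n /=; rewrite mulrA. Qed.

Let mulDl : left_distributive linf_mul +%R.
Proof. by move=> x y z; apply/val_inj/funext => n; exact: mulrDl. Qed.

Let mulDr : right_distributive linf_mul +%R.
Proof. by move=> x y z; apply/val_inj/funext => n; exact: mulrDr. Qed.

Let mulZl (k : C) x y : linf_mul (k *: x) y = k *: linf_mul x y.
Proof. by apply/val_inj/funext => n; apply/esym/mulrA. Qed.

Let mulZr (k : C) x y : linf_mul x (k *: y) = k *: linf_mul x y.
Proof. by apply/val_inj/funext => n; exact: mulrCA. Qed.

HB.instance Definition _ := Lmodule_isAssocAlgebra.Build C linf
  mulA mulDl mulDr mulZl mulZr.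

Let starK : involutive linf_star.
Proof. by move=> x; apply/val_inj/funext => n; exact: conjCK. Qed.

Let starD : {morph linf_star : x y / x + y}.
Proof. by move=> x y; apply/val_inj/funext => n; exact: rmorphD. Qed.

Let starZ (k : C) x : linf_star (k *: x) = Num.conj k *: linf_star x.
Proof. by apply/val_inj/funext => n; exact: rmorphM. Qed.

Let starM x y : linf_star (amul x y) = amul (linf_star y) (linf_star x).
Proof. by apply/val_inj/funext => n; rewrite /= rmorphM mulrC. Qed.

Let mul_le (x y : linf) : `|amul x y| <= `|x| * `|y|.
Proof.
by apply/linf_norm_le => n; rewrite normrM ler_pM ?linf_norm_ub.
Qed.

Let star_mul (x : linf) : `|amul (linf_star x) x| = `|x| ^+ 2.
Proof.
apply/eqP; rewrite eq_le; apply/andP; split.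
  apply/linf_norm_le => n /=; rewrite normrM norm_conjC -expr2.
  by rewrite lerXn2r ?nnegrE ?linf_norm_ub.
rewrite -[leRHS]sqrtCK lerXn2r ?nnegrE ?sqrtC_ge0//.
apply/linf_norm_le => n.
rewrite -(@ler_pXn2r _ 2) ?nnegrE ?sqrtC_ge0// sqrtCK.
have := linf_norm_ub (amul (linf_star x) x) n.
by rewrite /= normrM norm_conjC -expr2.
Qed.

HB.instance Definition _ := isCstarAlgebra.Build C linf
  starK starD starZ starM mul_le star_mul.

Definition c0 : set linf := [set x | val x n @[n --> \oo] --> (0 : C)].

End linf.

Arguments c0 R : clear implicits.

(* Main.v *)
Require Import Defs.
From HB Require Import structures.
From mathcomp Require Import all_boot all_order all_algebra.
From mathcomp Require Import all_classical all_reals all_analysis.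
From mathcomp Require Import complex.

(** Let [e : nat -> nat] take every value infinitely often, and send a bounded
    sequence [x] to [x \o e]. All operations of [linf R] are coordinatewise, so
    this is a *-homomorphism; [e] is surjective, so both sequences have the same
    values, and the map is isometric, hence injective. Every value of [x] is
    repeated infinitely often in [x \o e], so it vanishes as soon as [x \o e]
    converges to 0: the range meets [c0 R] in 0 only
    ([range_linf_reindex_c0]). The 2-adic valuation of [n.+1] is such an [e].

    An embedding of [A] into [linf R] followed by this map is again an
    embedding, and its range lies in the range of the map
    ([range_comp_off]). Subalgebras and closed subspaces are embedded by
    their inclusion. *)

Set Implicit Arguments.
Unset Strict Implicit.
Unset Printing Implicit Defensive.
Import Order.TTheory GRing.Theory Num.Theory.
Import numFieldNormedType.Exports.
Local Open Scope classical_set_scope.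
Local Open Scope ring_scope.
Local Open Scope complex_scope.

Lemma isometry_inj (K : numDomainType) (V W : normedZmodType K)
    (f : {additive V -> W}) :
  (forall x, `|f x| = `|x|) -> injective f.
Proof.
move=> fnorm x y fxy; apply/subr0_eq/normr0_eq0.
by rewrite -fnorm raddfB fxy subrr normr0.
Qed.

Lemma range_comp_off (K : pzRingType) (U V W : lmodType K) (Y : set W)
    (f : {linear V -> W}) (g : {linear U -> V}) :
  range f `&` Y = [set 0] -> range (f \o g) `&` Y = [set 0].
Proof.
move=> fY; apply/seteqP; split=> [_ [[u _ <-] Yfgu]|_ ->].
  by rewrite -fY; split=> //; exists (g u).
split; first by exists 0; rewrite // linear0.
have /(_ 0) : [set 0] `<=` range f `&` Y by rewrite fY.
by case.
Qed.

Section reindexing.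
Variables (R : realType) (e : nat -> nat).

Lemma bounded_seq_reindex (x : linf R) : val x \o e \in @bounded_seq R.
Proof.
have [M Mx] := bounded_seqP _ (valP x); apply/bounded_seqP; exists M => n.
exact: Mx.
Qed.

Definition linf_reindex (x : linf R) : linf R := Linf (bounded_seq_reindex x).

Lemma linf_reindex_is_linear : linear linf_reindex.
Proof. by move=> k x y; apply/val_inj/funext => n. Qed.

HB.instance Definition _ := GRing.isLinear.Build R[i] (linf R) (linf R) *:%R
  linf_reindex linf_reindex_is_linear.

Lemma linf_reindexM : {morph linf_reindex : x y / amul x y >-> amul x y}.
Proof. by move=> x y; apply/val_inj/funext => n. Qed.

Lemma linf_reindex_star : {morph linf_reindex : x / star x >-> star x}.
Proof. by move=> x; apply/val_inj/funext => n. Qed.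

Hypothesis e_infinite_fibre : forall m N, exists2 n, (N <= n)%N & e n = m.

Lemma norm_linf_reindex (x : linf R) : `|linf_reindex x| = `|x|.
Proof.
apply/eqP; rewrite eq_le; apply/andP; split; apply/linf_norm_le => n.
  exact: (linf_norm_ub x).
have [k _ <-] := e_infinite_fibre n 0.
exact: (linf_norm_ub (linf_reindex x)).
Qed.

Lemma linf_reindex_inj : injective linf_reindex.
Proof. exact: isometry_inj norm_linf_reindex. Qed.

(** If [x m] were nonzero, the terms of [x \o e] would eventually be smaller
    than [`|x m|], although [e] takes the value [m] arbitrarily far. *)
Lemma range_linf_reindex_c0 : range linf_reindex `&` c0 R = [set 0].
Proof.
apply/seteqP; split=> [_ [[x _ <-] xe0]|_ ->]; last first.
  by split; [exists 0; rewrite // linear0|exact: cvg_cst].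
suff -> : x = 0 by exact: linear0.
apply/val_inj/funext => m; apply: contrapT => /eqP xm0.
have xm_gt0 : 0 < `|val x m| by rewrite normr_gt0.
have [N _ Nlt] := cvgr0_norm_lt _ xe0 _ xm_gt0.
have [n Nn en] := e_infinite_fibre m N.
by have := Nlt n Nn; rewrite /= en ltxx.
Qed.

End reindexing.

Lemma logn2_infinite_fibre m N : exists2 n, (N <= n)%N & logn 2 n.+1 = m.
Proof.
(* [2 ^ m] times any odd number has valuation [m]; the odd factor [N.*2.+1]
   makes the product larger than [N]. *)
have pos : (0 < 2 ^ m * N.*2.+1)%N by rewrite muln_gt0 expn_gt0.
exists (2 ^ m * N.*2.+1).-1%N; last first.
  rewrite prednK// lognM ?expn_gt0// pfactorK// lognE.
  by rewrite dvdn2 /= odd_double addn0.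
rewrite -ltnS prednK//; apply: (@leq_trans N.*2.+1).
  by rewrite ltnS -addnn leq_addr.
by rewrite leq_pmull ?expn_gt0.
Qed.

Section embeddings_off_c0.
Variable R : realType.

Let spread : {linear linf R -> linf R} :=
  linf_reindex (R := R) (fun n => logn 2 n.+1).

Let spread_inj : injective spread.
Proof. exact: linf_reindex_inj logn2_infinite_fibre. Qed.

Let spread_off : range spread `&` c0 R = [set 0].
Proof. exact: range_linf_reindex_c0 logn2_infinite_fibre. Qed.

Lemma linf_embeddable_off_c0 : cstar_embeddable_off (c0 R) (linf R).
Proof.
exists spread; last exact: spread_off.
split; [exact: spread_inj|exact: linf_reindexM|exact: linf_reindex_star].
Qed.

Lemma algebra_embeddable_off_c0 (A : assocAlgType R[i]) :
  algebra_embeddable (linf R) A -> algebra_embeddable_off (c0 R) A.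
Proof.
case=> phi [phi_inj phiM].
exists (spread \o phi); last exact: range_comp_off spread_off.
split; first exact: inj_comp spread_inj phi_inj.
by move=> x y /=; rewrite phiM linf_reindexM.
Qed.

Lemma banach_embeddable_off_c0 (A : completeNormedModType R[i]) :
  banach_embeddable (linf R) A -> banach_embeddable_off (c0 R) A.
Proof.
case=> phi [phi_inj phi_norm].
exists (spread \o phi); last exact: range_comp_off spread_off.
split; first exact: inj_comp spread_inj phi_inj.
by move=> x /=; rewrite (norm_linf_reindex logn2_infinite_fibre) phi_norm.
Qed.

End embeddings_off_c0.

Lemma subalgebra_embeddable (K : numClosedFieldType) (B : cstarAlgType K)
    (S : subalgebra B) : algebra_embeddable B (subalgebra_type S).
Proof.
exists (val : {linear subalgebra_type S -> B}).
by split; first exact: val_inj.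
Qed.

Lemma closed_subspace_embeddable (K : numClosedFieldType) (B : cstarAlgType K)
    (S : closedSubspace B) : banach_embeddable B (subspace_type S).
Proof.
exists (val : {linear subspace_type S -> B}).
by split; first exact: val_inj.
Qed.

Theorem corollary2p8 (R : realType) :
  [/\ cstar_embeddable_off (c0 R) (linf R),
      (forall A : assocAlgType R[i],
         algebra_embeddable (linf R) A -> algebra_embeddable_off (c0 R) A),
      (forall A : completeNormedModType R[i],
         banach_embeddable (linf R) A -> banach_embeddable_off (c0 R) A),
      (forall S : subalgebra (linf R),
         algebra_embeddable_off (c0 R) (subalgebra_type S)) &
      (forall S : closedSubspace (linf R),
         banach_embeddable_off (c0 R) (subspace_type S))].
Proof.
split.
- exact: linf_embeddable_off_c0.
- exact: algebra_embeddable_off_c0.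
- exact: banach_embeddable_off_c0.
- by move=> S; exact/algebra_embeddable_off_c0/subalgebra_embeddable.
- by move=> S; exact/banach_embeddable_off_c0/closed_subspace_embeddable.
Qed.
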